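(* Let $P$ be a pattern. Then $ssat(P,n)=O(1)$ if and only if all of the following hold: (1) the first row of $P$ contains a $1$ entry that is the only $1$ entry in its column, and the last row of $P$ contains a $1$ entry that is the only $1$ entry in its column; (2) the first column of $P$ contains a $1$ entry that is the only $1$ entry in its row, and the last column of $P$ contains a $1$ entry that is the only $1$ entry in its row; (3) $P$ contains a $1$ entry that is the only $1$ entry in both its row and its column. Otherwise $ssat(P,n)=\Theta(n)$.
   Context: All matrices are $0$-$1$ matrices; an $m\times n$ matrix has $m$ rows and $n$ columns. The weight of a matrix is its number of $1$ entries. A pattern is a $0$-$1$ matrix that is not all-zero. An occurrence of a $k\times l$ pattern $P$ in a matrix $M$ is a choice of rows $r_1<\dots<r_k$ and columns $c_1<\dots<c_l$ of $M$ such that $M(r_a,c_b)=1$ whenever $P(a,b)=1$. $ssat(P,m,n)$ is the minimum weight of an $m\times n$ matrix $M$ (not required to avoid $P$) such that changing any single $0$ entry of $M$ to $1$ yields a matrix $M'$ containing a new occurrence of $P$, i.e. an occurrence of $P$ in $M'$ that is not an occurrence of $P$ in $M$. $ssat(P,n)=ssat(P,n,n)$. *)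

(* Defs.v *)
From HB Require Import structures.
From mathcomp Require Import all_boot all_order all_algebra.

Set Implicit Arguments.
Unset Strict Implicit.
Unset Printing Implicit Defensive.

(* A 0-1 matrix with m rows and n columns is a boolean matrix. *)

Definition weight (m n : nat) (M : 'M[bool]_(m, n)) : nat :=
  #|[set ij : 'I_m * 'I_n | M ij.1 ij.2]|.

Definition is_pattern (k l : nat) (P : 'M[bool]_(k, l)) : Prop :=
  P <> const_mx false.

Definition increasing (k m : nat) (r : {ffun 'I_k -> 'I_m}) : bool :=
  [forall a : 'I_k, forall b : 'I_k, (a < b) ==> (r a < r b)].

Definition occurrence (k l m n : nat) (P : 'M[bool]_(k, l))
    (M : 'M[bool]_(m, n))
    (r : {ffun 'I_k -> 'I_m}) (c : {ffun 'I_l -> 'I_n}) : bool :=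
  [&& increasing r, increasing c
    & [forall a, forall b, P a b ==> M (r a) (c b)]].

Definition set_one (m n : nat) (M : 'M[bool]_(m, n)) (i : 'I_m) (j : 'I_n) :
    'M[bool]_(m, n) :=
  \matrix_(x, y) (((x == i) && (y == j)) || M x y).

Definition semisaturating (k l m n : nat) (P : 'M[bool]_(k, l))
    (M : 'M[bool]_(m, n)) : bool :=
  [forall i, forall j, ~~ M i j ==>
    [exists r, exists c,
      occurrence P (set_one M i j) r c && ~~ occurrence P M r c]].

Lemma semisaturating_ones (k l m n : nat) (P : 'M[bool]_(k, l)) :
  semisaturating P (const_mx true : 'M[bool]_(m, n)).
Proof. by apply/forallP => i; apply/forallP => j; rewrite mxE. Qed.

(* The all-ones matrix only serves as a starting point for arg min: by
   semisaturating_ones the minimum is over a nonempty set, see ssat_attained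
   and ssat_le. *)
Definition ssat (k l : nat) (P : 'M[bool]_(k, l)) (m n : nat) : nat :=
  weight [arg min_(M < (const_mx true : 'M[bool]_(m, n)) | semisaturating P M)
            weight M].

Lemma ssat_attained (k l m n : nat) (P : 'M[bool]_(k, l)) :
  exists2 M : 'M[bool]_(m, n), semisaturating P M & weight M = ssat P m n.
Proof.
rewrite /ssat; case: arg_minnP => [|M sM _]; first exact: semisaturating_ones.
by exists M.
Qed.

Lemma ssat_le (k l m n : nat) (P : 'M[bool]_(k, l)) (M : 'M[bool]_(m, n)) :
  semisaturating P M -> ssat P m n <= weight M.
Proof.
move=> sM; rewrite /ssat; case: arg_minnP => [|N _ minN].
  exact: semisaturating_ones.
exact: minN.
Qed.

Definition sole_in_col (k l : nat) (P : 'M[bool]_(k, l))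
    (a : 'I_k) (b : 'I_l) : Prop :=
  P a b /\ forall a' : 'I_k, P a' b -> a' = a.

Definition sole_in_row (k l : nat) (P : 'M[bool]_(k, l))
    (a : 'I_k) (b : 'I_l) : Prop :=
  P a b /\ forall b' : 'I_l, P a b' -> b' = b.

Definition row_condition (k l : nat) (P : 'M[bool]_(k.+1, l.+1)) : Prop :=
  (exists b, sole_in_col P ord0 b) /\ (exists b, sole_in_col P ord_max b).

Definition column_condition (k l : nat) (P : 'M[bool]_(k.+1, l.+1)) : Prop :=
  (exists a, sole_in_row P a ord0) /\ (exists a, sole_in_row P a ord_max).

Definition isolated_entry_condition (k l : nat)
    (P : 'M[bool]_(k.+1, l.+1)) : Prop :=
  exists a b, sole_in_row P a b /\ sole_in_col P a b.

(* Main.v *)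
(* Changing a 0 entry (i, j) of M to 1 creates a new occurrence of P exactly
   when some 1 entry (a, b) of P can be placed on (i, j) with all the other 1
   entries of P on 1 entries of M.  Hence, if (1), (2) or (3) fails, every column
   or every row of a semisaturating M contains a 1, so M has weight at least n.
   For the upper bounds, call a row or column of M a border line if it is among
   the first or last K ones, where K is the number of rows plus the number of
   columns of P.  A line a of P can be placed on a line i of M with all the others
   on border lines, unless i is within K of an end beyond which P has further
   lines.  Filling all border rows and columns is semisaturating for every
   pattern and has weight O(n).  Filling only the intersections of border rows
   with border columns suffices under (1)-(3): (3) serves the entries on no border
   line, (1) those on a border row only, (2) those on a border column only. *)
Require Import Defs.
From HB Require Import structures.
From mathcomp Require Import all_boot all_order all_algebra.
From mathcomp Require Import zify boolp.
Import Order.TTheory GRing.Theory Num.Theory.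

Set Implicit Arguments.
Unset Strict Implicit.
Unset Printing Implicit Defensive.

(** * New occurrences created by changing one entry *)

Lemma increasing_inj (k m : nat) (r : {ffun 'I_k -> 'I_m}) :
  increasing r -> injective r.
Proof.
move=> /'forall_forallP r_incr a b rab; apply/val_inj => /=.
have := r_incr a b; have := r_incr b a; rewrite rab ltnn !implybF -!leqNgt.
by move=> ab ba; apply/eqP; rewrite eqn_leq ab ba.
Qed.

(** A new occurrence must send some 1 entry [(a, b)] of [P] to the changed entry; as [r] and [c] are
    injective, all other 1 entries of [P] land on entries that were already 1. *)
Lemma semisaturatingP (k l m n : nat) (P : 'M[bool]_(k, l))
    (M : 'M[bool]_(m, n)) :
  semisaturating P M <-> forall i j, ~~ M i j ->
    exists r c a b, [/\ increasing r, increasing c, P a b, r a = i & c b = j]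
      /\ forall a' b', P a' b' -> (a' != a) || (b' != b) -> M (r a') (c b').
Proof.
split=> [/'forall_forallP sM i j|newP].
  move=> /(implyP (sM i j)) /existsP[r /existsP[c]].
  case/andP=> /and3P[ir ic /'forall_forallP Po].
  rewrite /occurrence ir ic /= => /forallPn[a /forallPn[b]].
  rewrite negb_imply => /andP[Pab nM].
  have := implyP (Po a b) Pab; rewrite mxE (negPf nM) orbF.
  case/andP=> /eqP ra /eqP cb; exists r, c, a, b; split=> // a' b' Pab' ne.
  have := implyP (Po a' b') Pab'; rewrite mxE; case/orP=> //.
  rewrite -ra -cb (inj_eq (increasing_inj ir)) (inj_eq (increasing_inj ic)).
  by move=> /andP[aa bb]; rewrite aa bb in ne.
apply/'forall_forallP => i j; apply/implyP => nMij.
have [r [c [a [b [[ir ic Pab ra cb] Mrc]]]]] := newP i j nMij.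
apply/existsP; exists r; apply/existsP; exists c; rewrite /occurrence ir ic /=.
apply/andP; split.
  apply/'forall_forallP => a' b'; apply/implyP => Pab'; rewrite mxE.
  have [ne|] := boolP ((a' != a) || (b' != b)); first by rewrite Mrc ?orbT.
  by rewrite negb_or !negbK => /andP[/eqP-> /eqP->]; rewrite ra cb !eqxx.
apply/forallPn; exists a; apply/forallPn; exists b.
by rewrite negb_imply Pab ra cb.
Qed.

(** * Linear lower bounds *)

Lemma leq_weight_cols (m n : nat) (M : 'M[bool]_(m, n)) :
  (forall j, exists i, M i j) -> n <= weight M.
Proof.
move=> colM; rewrite -[leqLHS]card_ord -cardsT.
apply: leq_trans (leq_imset_card snd _); apply/subset_leq_card/subsetP => j _.
have [i Mij] := colM j; apply/imsetP; exists (i, j) => //.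
by rewrite inE.
Qed.

Lemma leq_weight_rows (m n : nat) (M : 'M[bool]_(m, n)) :
  (forall i, exists j, M i j) -> m <= weight M.
Proof.
move=> rowM; rewrite -[leqLHS]card_ord -cardsT.
apply: leq_trans (leq_imset_card fst _); apply/subset_leq_card/subsetP => i _.
have [j Mij] := rowM i; apply/imsetP; exists (i, j) => //.
by rewrite inE.
Qed.

Lemma not_sole_in_col (k l : nat) (P : 'M[bool]_(k, l)) a b :
  P a b -> ~ sole_in_col P a b -> exists2 a', P a' b & a' != a.
Proof.
move=> Pab nsole; apply/exists_inP; case: exists_inP => [//|nex]; case: nsole.
split=> // a' Pa'; apply/eqP/negPn/negP => ne; apply: nex.
by exists a'.
Qed.

Lemma not_sole_in_row (k l : nat) (P : 'M[bool]_(k, l)) a b :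
  P a b -> ~ sole_in_row P a b -> exists2 b', P a b' & b' != b.
Proof.
move=> Pab nsole; apply/exists_inP; case: exists_inP => [//|nex]; case: nsole.
split=> // b' Pb'; apply/eqP/negPn/negP => ne; apply: nex.
by exists b'.
Qed.

(** Meant for [i] the first or last row of [M], which only the corresponding row [a0] of [P] can
    reach. The 1 of row [a0] placed on a 0 entry [(i, j)] has a second 1 in its column, and that one
    lands on a 1 in column [j] of [M]. *)
Lemma semisaturating_cols (k l m n : nat) (P : 'M[bool]_(k, l))
    (M : 'M[bool]_(m, n)) (a0 : 'I_k) (i : 'I_m) :
  semisaturating P M ->
  (forall (r : {ffun 'I_k -> 'I_m}) a, increasing r -> r a = i -> a = a0) ->
  ~ (exists b, sole_in_col P a0 b) -> n <= weight M.
Proof.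
move=> sM only_a0 nsole; apply: leq_weight_cols => j.
have [Mij|nMij] := boolP (M i j); first by exists i.
have [r [c [a [b [[ir ic Pab ra cb] Mrc]]]]] :=
  (semisaturatingP P M).1 sM i j nMij.
have aE := only_a0 r a ir ra; rewrite aE in Pab.
have [|a' Pa'b ne] := not_sole_in_col Pab.
  by move=> ?; apply: nsole; exists b.
by exists (r a'); rewrite -cb Mrc // aE ne.
Qed.

Lemma semisaturating_rows (k l m n : nat) (P : 'M[bool]_(k, l))
    (M : 'M[bool]_(m, n)) (b0 : 'I_l) (j : 'I_n) :
  semisaturating P M ->
  (forall (c : {ffun 'I_l -> 'I_n}) b, increasing c -> c b = j -> b = b0) ->
  ~ (exists a, sole_in_row P a b0) -> m <= weight M.
Proof.
move=> sM only_b0 nsole; apply: leq_weight_rows => i.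
have [Mij|nMij] := boolP (M i j); first by exists j.
have [r [c [a [b [[ir ic Pab ra cb] Mrc]]]]] :=
  (semisaturatingP P M).1 sM i j nMij.
have bE := only_b0 c b ic cb; rewrite bE in Pab.
have [|b' Pab' ne] := not_sole_in_row Pab.
  by move=> ?; apply: nsole; exists a.
by exists (c b'); rewrite -ra Mrc // bE ne orbT.
Qed.

Lemma increasing_eq_ord0 (k m : nat) (r : {ffun 'I_k.+1 -> 'I_m.+1}) a :
  increasing r -> r a = ord0 -> a = ord0.
Proof.
move=> /'forall_forallP /(_ ord0 a) ir ra; apply/val_inj => /=.
by move: ir; rewrite ra ltn0 implybF -leqNgt leqn0 => /eqP.
Qed.

Lemma increasing_eq_ord_max (k m : nat) (r : {ffun 'I_k.+1 -> 'I_m.+1}) a :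
  increasing r -> r a = ord_max -> a = ord_max.
Proof.
move=> /'forall_forallP /(_ a ord_max) ir ra; apply/val_inj => /=.
by move: ir (ltn_ord (r ord_max)) (ltn_ord a); rewrite ra /=; lia.
Qed.

(** If some row [i] of [M] is empty, a 1 of [P] placed on [(i, j)] must be alone in its row, hence
    shares its column with another 1, which makes column [j] nonempty. *)
Lemma semisaturating_isolated (k l m n : nat) (P : 'M[bool]_(k.+1, l.+1))
    (M : 'M[bool]_(m, n)) :
  semisaturating P M -> ~ isolated_entry_condition P -> minn m n <= weight M.
Proof.
move=> sM niso.
have [/forallP rowM|/forallPn[i /existsPn rowi0]] :=
  boolP [forall i, exists j, M i j].
  apply: leq_trans (geq_minl m n) _; apply: leq_weight_rows => i.
  exact/existsP/rowM.
apply: leq_trans (geq_minr m n) _; apply: leq_weight_cols => j.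
have [r [c [a [b [[_ _ Pab ra cb] Mrc]]]]] :=
  (semisaturatingP P M).1 sM i j (rowi0 j).
have srow : sole_in_row P a b.
  split=> // b' Pab'; apply/eqP/negPn/negP => ne.
  by have := rowi0 (c b'); rewrite -ra Mrc // ne orbT.
have [|a' Pa'b ne] := not_sole_in_col Pab.
  by move=> scol; apply: niso; exists a, b.
by exists (r a'); rewrite -cb Mrc // ne.
Qed.

(** * Border lines and upper bounds *)

Definition near_border (K n i : nat) : bool := (i < K) || (n - K <= i).

Lemma card_near_border (K n : nat) :
  #|[set i : 'I_n | near_border K n i]| <= K.*2.
Proof.
have E : [set i : 'I_n | near_border K n i] \subset
   [set i : 'I_n | i < K] :|: [set i : 'I_n | rev_ord i < K].
  by apply/subsetP => i; rewrite !inE /near_border /=; have := ltn_ord i; lia.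
apply: leq_trans (subset_leq_card E) _; apply: leq_trans (leq_card_setU _ _) _.
have lowK : #|[set i : 'I_n | i < K]| <= K.
  rewrite -[leqRHS](card_ord K).
  have [->|/set0Pn[i0]] := eqVneq [set i : 'I_n | i < K] set0.
    by rewrite cards0.
  rewrite inE => i0K.
  (* [i0] only supplies the default value that [insubd] requires in ['I_K]; the default is never
     taken on this set. *)
  rewrite -(card_in_imset (f := fun i : 'I_n => insubd (Ordinal i0K) (val i))).
    exact: max_card.
  move=> i j; rewrite !inE => iK jK /(congr1 val).
  by rewrite !val_insubd iK jK => /val_inj.
rewrite -addnn leq_add //; apply: leq_trans lowK.
rewrite -(card_imset _ rev_ord_inj); apply/subset_leq_card/subsetP => i.
by case/imsetP=> x; rewrite !inE => xK ->.
Qed.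

Lemma border_embedding (k K n : nat) (a : 'I_k) (i : 'I_n) :
  k <= K -> K.*2 <= n -> (0 < a -> K <= i) -> (a.+1 < k -> i < n - K) ->
  exists r : {ffun 'I_k -> 'I_n}, [/\ increasing r, r a = i &
    forall a', a' != a -> near_border K n (r a')].
Proof.
move=> kK Kn ai ia.
(* Lines before [a] keep their distance from the start, lines after [a] their distance from the
   end. *)
pose f (x : 'I_k) : nat :=
  if x < a then x : nat else if x == a then i : nat else n - k + x.
have f_lt x : f x < n.
  by rewrite /f; have := ltn_ord x; have := ltn_ord i; repeat case: ifP; lia.
exists [ffun x => Ordinal (f_lt x)]; split.
- apply/'forall_forallP => x y; rewrite !ffunE /= /f; apply/implyP => xy.
  rewrite -!val_eqE /=; have := ltn_ord x; have := ltn_ord y.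
  by have := ltn_ord a; repeat case: ifP; lia.
- by rewrite ffunE; apply/val_inj; rewrite /= /f ltnn eqxx.
- move=> x xa; rewrite ffunE /= /near_border /f (negPf xa).
  move: xa; rewrite -val_eqE /=; have := ltn_ord x; have := ltn_ord a.
  by case: ifP; lia.
Qed.


(* [i'] and [j'] range over the lines that may receive row [a'] and column [b']
   of P once (a, b) is placed on (i, j). *)
Lemma border_semisaturating (k l K n : nat) (P : 'M[bool]_(k, l))
    (M : 'M[bool]_n) :
  k <= K -> l <= K -> K.*2 <= n ->
  (forall i j, ~~ M i j -> exists a b,
     [/\ P a b, (0 < a -> K <= i) /\ (a.+1 < k -> i < n - K),
         (0 < b -> K <= j) /\ (b.+1 < l -> j < n - K)
       & forall a' b', P a' b' -> (a' != a) || (b' != b) ->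
         forall i' j' : 'I_n,
           (if a' == a then i' = i else near_border K n i') ->
           (if b' == b then j' = j else near_border K n j') -> M i' j']) ->
  semisaturating P M.
Proof.
move=> kK lK Kn fitM; apply/semisaturatingP => i j nMij.
have [a [b [Pab [a1 a2] [b1 b2] Mother]]] := fitM i j nMij.
have [r [ir ra rb]] := border_embedding kK Kn a1 a2.
have [c [ic cb cB]] := border_embedding lK Kn b1 b2.
exists r, c, a, b; split=> // a' b' Pab' ne; apply: (Mother a' b') => //.
  by case: eqVneq => [->|/rb].
by case: eqVneq => [->|/cB].
Qed.

Lemma ssat_linear (k l n : nat) (P : 'M[bool]_(k, l)) a b :
  P a b -> (k + l).*2 <= n -> ssat P n n <= (k + l).*2.*2 * n.
Proof.
move=> Pab Kn; set K := k + l in Kn *.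
pose M : 'M[bool]_n :=
  (\matrix_(i, j) (near_border K n i || near_border K n j))%R.
have /ssat_le/leq_trans->// : semisaturating P M.
  apply: (@border_semisaturating _ _ K); rewrite ?leq_addr ?leq_addl // => i j.
  (* A 0 entry of [M] lies on no border line, so any 1 entry of [P] can be placed there; every other
     1 differs in its row or its column and so lands on a border line. *)
  rewrite mxE => nM; exists a, b; split=> //.
  1,2: by move: nM; rewrite /near_border; split; lia.
  move=> a' b' _ ne i' j'; rewrite mxE.
  move: ne; case: eqVneq => [_ /= /negPf->|_ _ -> //].
  by move=> _ ->; rewrite orbT.
have : [set ij : 'I_n * 'I_n | M ij.1 ij.2] \subset
    setX [set i : 'I_n | near_border K n i] setT :|:
    setX setT [set j : 'I_n | near_border K n j].
  by apply/subsetP => -[i j]; rewrite !inE mxE /= andbT.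
move/subset_leq_card; rewrite -/(weight M) => /leq_trans; apply.
apply: leq_trans (leq_card_setU _ _) _; rewrite !cardsX cardsT card_ord.
by have := card_near_border K n; nia.
Qed.

Lemma ssat_bounded (k l n : nat) (P : 'M[bool]_(k.+1, l.+1)) :
  [/\ row_condition P, column_condition P & isolated_entry_condition P] ->
  (k.+1 + l.+1).*2 <= n -> ssat P n n <= (k.+1 + l.+1).*2 * (k.+1 + l.+1).*2.
Proof.
move=> [[[bt [Pt solet]] [bb [Pb soleb]]] [[al [Pl solel]] [ar [Pr soler]]]].
move=> [ai [bi [[Pi solei] [_ solei']]]] Kn; set K := k.+1 + l.+1 in Kn *.
pose M : 'M[bool]_n :=
  (\matrix_(i, j) (near_border K n i && near_border K n j))%R.
have /ssat_le/leq_trans->// : semisaturating P M.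
  apply: (@border_semisaturating _ _ K); rewrite ?leq_addr ?leq_addl // => i j.
  rewrite mxE; have [iB|iN] := boolP (near_border K n i); last first.
    have [jB|jN] := boolP (near_border K n j); last first.
      move=> _; exists ai, bi; split=> //.
      1,2: by move: iN jN; rewrite /near_border; split; lia.
      move=> a' b' Pab' ne i' j'; rewrite mxE.
      case: eqVneq ne Pab' => [-> /= /eqP ne /solei //|/eqP na _].
      by case: eqVneq => [-> /solei'//|_ _ -> ->].
    (* The end of the column range near [j] decides between the first and last columns of [P]. The
       chosen 1 is alone in its row, so every other 1 goes to a border row, and its column is [j] or
       another border column. *)
    move=> _; have [jK|jK] := ltnP j K.
      exists al, ord0; split=> //.
      1,2: by move: iN jB; rewrite /near_border /=; split; lia.
      move=> a' b' Pab' ne i' j'; rewrite mxE.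
      case: eqVneq ne Pab' => [-> /= /eqP ne /solel //|_ _ _ ->].
      by case: eqVneq => [_ ->|_ ->].
    exists ar, ord_max; split=> //.
    1,2: by move: iN jB; rewrite /near_border /=; split; lia.
    move=> a' b' Pab' ne i' j'; rewrite mxE.
    case: eqVneq ne Pab' => [-> /= /eqP ne /soler //|_ _ _ ->].
    by case: eqVneq => [_ ->|_ ->].
  move=> jN; have [iK|iK] := ltnP i K.
    exists ord0, bt; split=> //.
    1,2: by move: jN iB; rewrite /near_border /=; split; lia.
    move=> a' b' Pab' ne i' j'; rewrite mxE.
    have [E|_] := eqVneq b' bt.
      by move: ne Pab'; rewrite E eqxx orbF => /eqP ne /solet.
    by case: eqVneq => [_ ->|_ ->] ->; rewrite ?iB.
  exists ord_max, bb; split=> //.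
  1,2: by move: jN iB; rewrite /near_border /=; split; lia.
  move=> a' b' Pab' ne i' j'; rewrite mxE.
  have [E|_] := eqVneq b' bb.
    by move: ne Pab'; rewrite E eqxx orbF => /eqP ne /soleb.
  by case: eqVneq => [_ ->|_ ->] ->; rewrite ?iB.
have -> : weight M = #|setX [set i : 'I_n | near_border K n i]
                            [set j : 'I_n | near_border K n j]|.
  by apply: eq_card => -[i j]; rewrite !inE mxE.
by rewrite cardsX leq_mul ?card_near_border.
Qed.

Lemma ssat_ge (k l n : nat) (P : 'M[bool]_(k.+1, l.+1)) :
  ~ [/\ row_condition P, column_condition P & isolated_entry_condition P] ->
  n <= ssat P n n.
Proof.
(* The case [n = 0] is trivial; otherwise [M] has first and last lines. *)
move=> nP; have [M sM <-] := ssat_attained n n P; case: n M sM => // n M sM.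
rewrite leqNgt; apply/negP => small; apply: nP.
split; [split|split|]; apply: contrapT => nsole; move: small; rewrite ltnNge.
- by rewrite (semisaturating_cols sM (@increasing_eq_ord0 _ _) nsole).
- by rewrite (semisaturating_cols sM (@increasing_eq_ord_max _ _) nsole).
- by rewrite (semisaturating_rows sM (@increasing_eq_ord0 _ _) nsole).
- by rewrite (semisaturating_rows sM (@increasing_eq_ord_max _ _) nsole).
- by have := semisaturating_isolated sM nsole; rewrite minnn => ->.
Qed.

(* Asymptotic formulation *)
From mathcomp Require Import classical_sets reals topology normedtype landau.
Import numFieldNormedType.Exports.
Local Open Scope classical_set_scope.
Local Open Scope ring_scope.

Lemma natr_bigO (R : realType) (f g : nat -> nat) (C N : nat) :
  (forall n, N <= n -> f n <= C * g n)%N ->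
  (fun n => (f n)%:R : R) =O_\oo (fun n => (g n)%:R : R).
Proof.
(* The constant must be positive, whereas [C] may be 0. *)
move=> fg; apply/eqO_exP; exists C.+1%:R; first by rewrite /= ltr0n.
exists N => // n /= /fg fgn; rewrite !normr_nat -natrM ler_nat.
by rewrite (leq_trans fgn) // leq_mul.
Qed.

(** An index beyond both the threshold and the Archimedean bound of the constant gives a
    contradiction. *)
Lemma natr_not_bigO1 (R : realType) (f : nat -> nat) :
  (forall n, n <= f n)%N ->
  ~ (fun n => (f n)%:R : R) =O_\oo (fun _ => 1 : R).
Proof.
move=> nf /eqO_exP[C C0 [N _ fC]]; pose n := maxn N (Num.bound C).
have := fC n (leq_maxl _ _); rewrite /= normr1 mulr1 normr_nat leNgt.
move=> /negP; apply.
apply: lt_le_trans (archi_boundP (ltW C0)) _.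
by rewrite ler_nat (leq_trans (leq_maxr N _)) ?nf.
Qed.

Theorem theorem8 (R : realType) (k l : nat) (P : 'M[bool]_(k.+1, l.+1))
    (hP : is_pattern P) :
  ((fun n : nat => (ssat P n n)%:R : R) =O_\oo (fun _ : nat => 1 : R)
     <-> [/\ row_condition P, column_condition P & isolated_entry_condition P])
  /\
  (~ [/\ row_condition P, column_condition P & isolated_entry_condition P] ->
   (fun n : nat => (ssat P n n)%:R : R) =Theta_\oo (fun n : nat => n%:R : R)).
Proof.
set good := [/\ _, _ & _]; split.
  split=> [bounded|goodP].
    apply: contrapT => badP; apply: (@natr_not_bigO1 R _ _ bounded) => n.
    exact: ssat_ge.
  apply: (@natr_bigO R (fun n => ssat P n n) (fun=> 1%N)
    ((k.+1 + l.+1).*2 * (k.+1 + l.+1).*2)%N (k.+1 + l.+1).*2) => n Kn.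
  by rewrite muln1 ssat_bounded.
move=> badP; rewrite eqThetaE bigThetaE eqOmegaO; split.
  have [a [b Pab]] : exists a b, P a b.
    apply: contrapT => P0; apply: hP; apply/matrixP => a b; rewrite mxE.
    by apply/negP => Pab; apply: P0; exists a, b.
  apply: (@natr_bigO R _ id (k.+1 + l.+1).*2.*2 (k.+1 + l.+1).*2) => n Kn.
  exact: ssat_linear Pab Kn.
(* The Omega half, read as [n] being big O of [ssat P n n]. *)
apply: (@natr_bigO R id _ 1%N 0%N) => n _; rewrite mul1n; exact: ssat_ge.
Qed.
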